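(* Let $k\ge 1$ be an integer and let $\sigma=\langle k^\infty\rangle\in(0,1)$ be the irrational number all of whose continued fraction partial quotients equal $k$. Let $f:\mathbb{C}\to\mathbb{C}$ be a polynomial with $f(0)=0$ and $f'(0)=e^{2\pi i\sigma}$, let $\mathcal{D}$ be its Siegel disk around $0$, and assume that $\partial\mathcal{D}$ is a Jordan curve containing exactly one critical point $c$ of $f$. Let $\chi:\mathbb{T}=\mathbb{R}/\mathbb{Z}\to\partial\mathcal{D}$ be the dynamically natural parameterization of $\partial\mathcal{D}$, so that $\chi$ is continuous, $\chi(0)=c$ and $f(\chi(t))=\chi(t+\sigma)$ for all $t\in\mathbb{T}$. Let $P_m/Q_m=\langle k^m\rangle$ in lowest terms, and assume that the scaling exponent $$\alpha=\lim_{m\to\infty}\frac{f^{Q_{m+1}}(c)-c}{f^{Q_m}(c)-c}$$ exists, is nonzero, and that there is a constant $C_2>0$ such that $$|f^{Q_m}(c)-c| = C_2|\alpha|^m+o(|\alpha|^m)\quad\text{as } m\to\infty .$$ Put $\kappa_{\max}=\dfrac{\log|\alpha|}{\log\sigma}$ and assume that $\kappa_{\max}$ is not an integer. Then for every non-integer $\kappa>\kappa_{\max}$ the function $\chi$ is not of class $C^{\kappa}$ on $\mathbb{T}$.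
   Context: Continued fractions: $\langle b_1b_2\ldots b_q\rangle=\cfrac{1}{b_1+\cfrac{1}{b_2+\cdots+\cfrac{1}{b_q}}}$; $\langle k^m\rangle$ is the continued fraction with $m$ partial quotients all equal to $k$, and $\langle k^\infty\rangle=\lim_{m\to\infty}\langle k^m\rangle$. $f^n$ denotes the $n$-th iterate of $f$. Siegel disk: for $f$ as in the claim, with $a=e^{2\pi i\sigma}$, Siegel's theorem gives a unique analytic map $h$ on an open disk around $0$ with $h(0)=0$, $h'(0)=1$ and $f(h(z))=h(az)$. Let $r_S$ be the radius of the largest disk $B(0,r_S)$ centered at $0$ on which such an $h$ exists; the Siegel disk is $\mathcal{D}=h(B(0,r_S))$. The map $h$ is univalent on $B(0,r_S)$ and, when $\partial\mathcal{D}$ is a Jordan curve, extends continuously to the closed disk. Dynamically natural parameterization: $\chi(t)=h\left(r_S\,e^{2\pi i(t+\theta)}\right)$, $t\in\mathbb{T}$, where $h$ denotes the continuous extension to the closed disk and the constant $\theta$ is chosen so that $\chi(0)=c$. Hölder classes: for non-integer $\kappa=n+\kappa'>0$ with $n\in\{0,1,2,\ldots\}$ and $\kappa'\in(0,1)$, a function $\phi$ on $\mathbb{T}$ is of class $C^\kappa$ if $\phi^{(n)}$ exists and there is $C>0$ with $|\phi^{(n)}(t)-\phi^{(n)}(s)|\le C|t-s|^{\kappa'}$ for all $t,s\in\mathbb{T}$, where $|t-s|$ is the distance on $\mathbb{T}$. A complex-valued function is $C^\kappa$ if and only if its real and imaginary parts are. *)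

(* Defs.v *)
From HB Require Import structures.
From mathcomp Require Import all_boot all_order all_algebra.
From mathcomp Require Import complex.
From mathcomp Require Import all_classical all_reals all_analysis.

Set Implicit Arguments.
Unset Strict Implicit.
Unset Printing Implicit Defensive.

Import Order.TTheory GRing.Theory Num.Theory.
Import numFieldNormedType.Exports.

Local Open Scope classical_set_scope.
Local Open Scope ring_scope.

(* [R[i]] carries no topology by itself; its regular module [R[i]^o] gets the
   norm topology of a numFieldType. [normc] below is the real-valued modulus
   (the norm `|z| of [R[i]] takes its values in [R[i]]). *)
Notation Cplx R := ((complex R)^o)%type.
Notation normc := Normc.normc.

(* cfrac [:: b_1; ...; b_q] = 1/(b_1 + 1/(b_2 + ... + 1/b_q)) *)
Fixpoint cfrac (F : fieldType) (s : seq nat) : F :=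
  if s is b :: s' then (b%:R + cfrac F s')^-1 else 0.

(* Denominator Q_m of <k^m> = P_m/Q_m in lowest terms ([denq] is the positive
   denominator of the reduced form of a rational). *)
Definition cf_denom (k m : nat) : nat := absz (denq (cfrac rat (nseq m k))).

(* e^(2 pi i t) *)
Definition expi2pi (R : realType) (t : R) : Cplx R :=
  Complex (cos (2 * pi * t)) (sin (2 * pi * t)).

Definition open_disk (R : realType) (r : R) : set (Cplx R) :=
  [set z | normc z < r].

Definition closed_disk (R : realType) (r : R) : set (Cplx R) :=
  [set z | normc z <= r].

Definition boundary (T : topologicalType) (A : set T) : set T :=
  closure A `\` A°.

Definition is_jordan_curve (R : realType) (A : set (Cplx R)) : Prop :=
  exists gamma : R -> Cplx R,
    [/\ {within `[0, 1], continuous gamma},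
        gamma 0 = gamma 1,
        (forall s t, 0 <= s < 1 -> 0 <= t < 1 -> gamma s = gamma t -> s = t)
      & gamma @` `[0, 1] = A].

(* h linearizes f at 0 on the disk of radius r: it is analytic there, i.e.
   complex differentiable at every point ([derivable] and [is_derive] are taken
   over the field R[i], in the direction 1), h(0) = 0, h'(0) = 1 and
   f(h(z)) = h(az). The values of h outside of the disk are irrelevant. *)
Definition linearizes (R : realType) (f : {poly R[i]}) (a : Cplx R) (r : R)
    (h : Cplx R -> Cplx R) : Prop :=
  [/\ forall z, open_disk r z -> derivable h z 1,
      h 0 = 0,
      is_derive (0 : Cplx R) (1 : Cplx R) h 1
    & forall z, open_disk r z -> f.[h z] = h (a * z)].

(* h is the linearization of f on the largest possible disk, of radius r. *)
Definition maximal_linearization (R : realType) (f : {poly R[i]})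
    (a : Cplx R) (r : R) (h : Cplx R -> Cplx R) : Prop :=
  [/\ 0 < r, linearizes f a r h
    & forall r' h', 0 < r' -> linearizes f a r' h' -> r' <= r].

Definition siegel_disk (R : realType) (r : R) (h : Cplx R -> Cplx R) :
  set (Cplx R) := h @` open_disk r.

Definition continuous_extension (R : realType) (r : R)
    (h hbar : Cplx R -> Cplx R) : Prop :=
  {within closed_disk r, continuous hbar} /\
  (forall z, open_disk r z -> hbar z = h z).

(* Functions on T = R/Z are represented by 1-periodic functions on R. *)
Definition natural_param (R : realType) (r theta : R)
    (hbar : Cplx R -> Cplx R) (t : R) : Cplx R :=
  hbar (real_complex R r * expi2pi (t + theta)).

(* distance on R/Z between the classes of t and s *)
Definition circle_dist (R : realType) (t s : R) : R :=
  inf [set `|t - s + m%:~R| | m in [set: int]].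

Definition holder_real (R : realType) (kappa : R) (phi : R -> R) : Prop :=
  exists (n : nat) (kappa' : R),
    [/\ 0 < kappa' < 1,
        kappa = n%:R + kappa',
        (forall i t, (i < n)%N -> derivable (derive1n i phi) t 1)
      & exists2 C, 0 < C & forall t s,
          `|derive1n n phi t - derive1n n phi s|
            <= C * circle_dist t s `^ kappa'].

(* Class C^kappa on T for a complex-valued function. *)
Definition holder_class (R : realType) (kappa : R) (phi : R -> Cplx R) : Prop :=
  holder_real kappa (fun t => complex.Re (phi t)) /\
  holder_real kappa (fun t => complex.Im (phi t)).

(* Main.v *)
Require Import Defs.
From HB Require Import structures.
From mathcomp Require Import all_boot all_order all_algebra.
From mathcomp Require Import complex.
From mathcomp Require Import all_classical all_reals all_analysis.
From mathcomp Require Import ring lra.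

Import Order.TTheory GRing.Theory Num.Theory.
Import numFieldNormedType.Exports.

Local Open Scope classical_set_scope.
Local Open Scope ring_scope.

(* With u_m = Q_m sigma - P_m = (-sigma)^m sigma, the conjugacy of f on the
   boundary of the disk to the rotation by sigma gives
   f^{Q_m}(c) - c = chi(u_m) - chi(0), a quantity of exact order |alpha|^m,
   hence of exact order |u_m|^kappa_max. If chi were C^kappa with
   kappa > kappa_max, then chi - chi(0) would be a polynomial up to
   O(|x|^kappa). A polynomial which is O(|u_m|^kappa_max) along u_m -> 0 has
   its lowest monomial of degree at least kappa_max, so, kappa_max not being an
   integer, of degree larger than kappa_max; hence chi(u_m) - chi(0) would be
   o(|u_m|^kappa_max), a contradiction. *)

(** * Reduced forms of $\langle k^m\rangle$ and the approximation of $\sigma$ *)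

(** If $x=n/d$ is reduced, then $1/(k+x)=d/(kd+n)$, and this fraction is again reduced because
    $\gcd(d,kd+n)=\gcd(d,n)=1$. *)
Lemma cfrac_nseqS_rat (k m : nat) : (1 <= k)%N ->
  let x := cfrac rat (nseq m k) in let y := cfrac rat (nseq m.+1 k) in
  [/\ 0 <= numq x, numq y = denq x & denq y = k%:Z * denq x + numq x].
Proof.
move=> k1 x y.
have x0 : 0 <= x.
  rewrite {}/x; elim: m {y} => //= m IH.
  by rewrite invr_ge0 addr_ge0.
have n0 : 0 <= numq x by rewrite numq_ge0.
have d0 : 0 < k%:Z * denq x + numq x.
  by rewrite ltr_pwDl // mulr_gt0 // ltz_nat.
have yE : y = (denq x)%:~R / (k%:Z * denq x + numq x)%:~R.
  rewrite /y /= -/x -{1}(divq_num_den x) intrD intrM.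
  have dn0 : (denq x)%:~R != 0 :> rat by rewrite intr_eq0 denq_neq0.
  rewrite -[RHS]invf_div; congr GRing.inv.
  by rewrite mulrDl mulfK.
have cop : coprime `|denq x| `|k%:Z * denq x + numq x|.
  have := coprime_num_den x.
  rewrite coprime_sym; have [p ->] : exists p : nat, numq x = p.
    by exists `|numq x|%N; rewrite gez0_abs.
  have [q ->] : exists q : nat, denq x = q.
    by exists `|denq x|%N; rewrite gez0_abs ?denq_ge0.
  by rewrite -PoszM -PoszD !absz_nat /coprime gcdnMDl.
split=> //; rewrite yE.
  by rewrite coprimeq_num // gtr0_sg // mul1r.
by rewrite coprimeq_den // gt_eqF // gtr0_norm.
Qed.

(** One step of the recursion multiplies the error by $-\sigma$: the difference of $(kd+n)\sigma-d$
    and $-\sigma(d\sigma-n)$ is $d(\sigma(k+\sigma)-1)=0$. *)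
Lemma cf_denom_approx (R : realType) (k m : nat) (sigma : R) : (1 <= k)%N ->
  sigma * (k%:R + sigma) = 1 ->
  exists p : int, (cf_denom k m)%:R * sigma - p%:~R = (- sigma) ^+ m * sigma.
Proof.
move=> k1 sE; exists (numq (cfrac rat (nseq m k))).
have -> : (cf_denom k m)%:R = (denq (cfrac rat (nseq m k)))%:~R :> R.
  by rewrite /cf_denom pmulrn gez0_abs ?denq_ge0.
elim: m => [|m IH].
  (* The empty fraction is $0/1$, so the errors start at $\sigma$ and not at $1$. *)
  by rewrite /= (_ : denq 0 = 1) // (_ : numq 0 = 0) // !mul1r subr0.
have [_ -> ->] := cfrac_nseqS_rat k m k1.
rewrite exprS -mulrA -IH intrD intrM -!pmulrn.
apply/eqP; rewrite -subr_eq0.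
rewrite (_ : _ - _ = (denq (cfrac rat (nseq m k)))%:~R *
  (sigma * (k%:R + sigma) - 1)); last by ring.
by rewrite sE subrr mulr0.
Qed.

(** * The exponential $e^{2\pi i t}$ and the distance on the circle *)

Lemma expi2piD (R : realType) (s t : R) : expi2pi (s + t) = expi2pi s * expi2pi t.
Proof.
rewrite /expi2pi mulrDr cosD sinD; congr Complex.
by rewrite addrC mulrC [X in _ + X]mulrC addrC.
Qed.

Lemma normc_expi2pi (R : realType) (t : R) : normc (expi2pi t) = 1.
Proof. by rewrite /expi2pi /= cos2Dsin2 sqrtr1. Qed.

Lemma expi2pi_nat (R : realType) (n : nat) : expi2pi n%:R = 1 :> Cplx R.
Proof.
elim: n => [|n IH]; first by rewrite /expi2pi mulr0 cos0 sin0.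
rewrite -natr1 expi2piD IH mul1r /expi2pi mulr1.
by rewrite mulr_natl cos2pi sin2pi.
Qed.

Lemma expi2pi_int (R : realType) (p : int) : expi2pi p%:~R = 1 :> Cplx R.
Proof.
case: p => n; first exact: expi2pi_nat.
rewrite NegzE mulrNz -[LHS]mulr1 -{1}(expi2pi_nat R n.+1) -expi2piD addNr.
exact: (expi2pi_nat R 0).
Qed.

Lemma circle_dist_bounds (R : realType) (t s : R) :
  0 <= circle_dist t s <= `|t - s|.
Proof.
have lb : lbound [set `|t - s + m%:~R| | m in [set: int]] 0.
  by move=> _ [m _ <-].
have ts : [set `|t - s + m%:~R| | m in [set: int]] `|t - s|.
  by exists 0 => //; rewrite addr0.
apply/andP; split; first by apply: lb_le_inf => //; exists `|t - s|.
by apply: ge_inf => //; exists 0.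
Qed.

(** * Taylor approximation of Hölder functions at $0$ *)

Lemma poly_antiderivative (R : numFieldType) (q : {poly R}) (a : R) :
  exists2 p : {poly R}, p.[0] = a & p^`() = q.
Proof.
exists (a%:P + 'X * \poly_(i < size q) (q`_i / i.+1%:R)).
  by rewrite !hornerE.
apply/polyP => i; rewrite coef_deriv coefD coefC coefXM add0r /= coef_poly.
case: ltnP => [_|szq]; last by rewrite nth_default // mul0rn.
by rewrite -[LHS]mulr_natr divfK // pnatr_eq0.
Qed.

Lemma MVT_from0 (R : realType) (g : R -> R) (x : R) :
  (forall t, derivable g t 1) ->
  exists2 c, `|c| <= `|x| & g x - g 0 = g^`()%classic c * x.
Proof.
move=> dg.
have cont a b : {within `[a, b], continuous g}.
  apply: continuous_subspaceT => t.
  by apply/differentiable_continuous/derivable1_diffP.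
have isd t : is_derive (t : R) 1 g (g^`()%classic t).
  by rewrite derive1E; apply: derivableP.
have [x0|x0] := leP 0 x.
  have [c] := MVT_segment x0 (fun t _ => isd t) (cont 0 x).
  rewrite in_itv /= => /andP[c0 cx] ->; exists c; last by rewrite subr0.
  by rewrite !ger0_norm.
have [c] := MVT_segment (ltW x0) (fun t _ => isd t) (cont x 0).
rewrite in_itv /= => /andP[xc c0] E; exists c.
  by rewrite !ler0_norm ?lerN2 // ltW.
by rewrite -opprB E sub0r mulrN opprK.
Qed.

(** Induction on [n], applied to $\phi'$: if [q] approximates $\phi'$, take its antiderivative [p]
    with $p(0)=\phi(0)$. The mean value theorem for $\phi-p$ then raises the exponent of the error
    by one. *)
Lemma taylor_holder (R : realType) (n : nat) (s C : R) (phi : R -> R) :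
  0 < s -> 0 <= C ->
  (forall i t, (i < n)%N -> derivable (derive1n i phi) t 1) ->
  (forall t, `|derive1n n phi t - derive1n n phi 0| <= C * `|t| `^ s) ->
  exists p : {poly R}, forall x, `|phi x - p.[x]| <= C * `|x| `^ (n%:R + s).
Proof.
move=> s0 C0; elim: n phi => [|n IH] phi dphi hphi.
  by exists (phi 0)%:P => x; rewrite hornerC add0r.
have [||q hq] := IH phi^`()%classic.
- by move=> i t ltin; have := dphi i.+1 t ltin; rewrite /derive1n iterSr.
- by move=> t; have := hphi t; rewrite /derive1n iterSr.
have [p p0 dp] := poly_antiderivative _ q (phi 0).
exists p => x.
have dphi0 t : derivable phi t 1 by exact: (dphi 0).
have dg t : derivable (phi - horner p) t 1.
  by apply: derivableB => //; exact: derivable_horner.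
have [c cx] := MVT_from0 _ _ x dg.
rewrite !fctE p0 subrr subr0 => ->.
have -> : (phi - horner p)^`()%classic c = phi^`()%classic c - q.[c].
  rewrite -dp derivE !derive1E deriveB //; exact: derivable_horner.
rewrite normrM.
have [->|x0] := eqVneq x 0; first by rewrite normr0 mulr0 mulr_ge0 ?powR_ge0.
have -> : `|x| `^ (n.+1%:R + s) = `|x| `^ (n%:R + s) * `|x|.
  rewrite -natr1 addrAC powRD; last by rewrite normr_eq0 x0 implybT.
  by rewrite powRr1.
rewrite mulrA ler_wpM2r //; apply: le_trans (hq c) _.
rewrite ler_wpM2l // ge0_ler_powR ?nnegrE //.
by rewrite addr_ge0 // ltW.
Qed.

Lemma holder_real_taylor (R : realType) (kappa : R) (phi : R -> R) :
  holder_real kappa phi ->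
  exists (p : {poly R}) (C : R), 0 <= C /\
    forall x, `|phi x - p.[x]| <= C * `|x| `^ kappa.
Proof.
move=> [n [s [/andP[s0 s1] -> dphi [C C0 hC]]]].
have [|p hp] := taylor_holder _ n s C phi s0 (ltW C0) dphi.
  (* The distance on the circle is at most that on the line, so the Hölder bound passes to
     $\mathbb{R}$. *)
  move=> t; apply: le_trans (hC t 0) _.
  have /andP[d0] := circle_dist_bounds _ t 0; rewrite subr0 => d1.
  by rewrite ler_wpM2l ?(ltW C0) // ge0_ler_powR ?nnegrE // ltW.
by exists p, C; split => //; exact: ltW.
Qed.

(** * Polynomials and Hölder functions along a null sequence *)

Lemma cvg_powR0 (R : realType) (u : nat -> R) (s : R) : 0 < s ->
  (forall m, u m != 0) -> u m @[m --> \oo] --> 0 ->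
  `|u m| `^ s @[m --> \oo] --> 0.
Proof.
move=> s0 u0 u_cvg; have /cvg_at_rightP := powR_cvg0 s0; apply; split.
  by move=> n; rewrite normr_gt0.
by rewrite -(@normr0 _ R); apply: cvg_norm.
Qed.

Lemma cvg_mulr0 (R : realType) (u v : nat -> R) (a : R) :
  u m @[m --> \oo] --> a -> v m @[m --> \oo] --> 0 ->
  u m * v m @[m --> \oo] --> 0.
Proof. by move=> ua v0; rewrite -[0 in X in _ --> X](mulr0 a); exact: cvgM. Qed.

(** Write $p=X^jq$ with $q(0)\neq 0$, so that $|p(u_m)|$ has exact order $|u_m|^j$; the claim then
    amounts to $b<j$. *)
Lemma horner_littleo (R : realType) (p : {poly R}) (u : nat -> R) (b A : R) :
  (forall m, u m != 0) -> u m @[m --> \oo] --> 0 ->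
  (forall n : nat, b != n%:R) ->
  (\forall m \near \oo, `|p.[u m]| <= A * `|u m| `^ b) ->
  `|p.[u m]| / `|u m| `^ b @[m --> \oo] --> 0.
Proof.
move=> u0 u_cvg bn bnd; have [j [q q0 pE]] := multiplicity_XsubC p 0.
have [p0|p0] := eqVneq p 0.
  by apply: cvg_near_cst; apply: nearW => m; rewrite p0 horner0 normr0 mul0r.
have {}q0 : q.[0] != 0 by move: q0; rewrite p0 /= /root.
have ub m c : 0 < `|u m| `^ c by rewrite powR_gt0 // normr_gt0.
have pu m : `|p.[u m]| = `|q.[u m]| * `|u m| `^ j%:R.
  by rewrite pE !hornerE subr0 normrM normrX powR_mulrn.
have q_cvg : `|q.[u m]| @[m --> \oo] --> `|q.[0]|.
  apply: cvg_norm.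
  exact: (cvg_comp u (horner q) u_cvg (@continuous_horner _ q 0)).
have pwB m c c' : `|u m| `^ (c - c') = `|u m| `^ c / `|u m| `^ c'.
  by rewrite powRB // normr_eq0 u0 implybT.
have [bj|jb|bj] := ltrgtP b j%:R.
- have E m : `|p.[u m]| / `|u m| `^ b = `|q.[u m]| * `|u m| `^ (j%:R - b).
    by rewrite pu -mulrA -pwB.
  rewrite (eq_cvg _ _ E); apply: cvg_mulr0 q_cvg _.
  by apply: cvg_powR0 => //; rewrite subr_gt0.
(* For $j<b$ the assumed bound gives $|q(u_m)|\le A|u_m|^{b-j}\to 0$, against $q(0)\neq 0$. *)
- suff : `|q.[0]| <= 0 by rewrite normr_le0 (negPf q0).
  have lim0 : A * `|u m| `^ (b - j%:R) @[m --> \oo] --> 0.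
    apply: (@cvg_mulr0 _ (fun=> A)); first exact: cvg_cst.
    by apply: cvg_powR0 => //; rewrite subr_gt0.
  apply: ler_cvg_to q_cvg lim0 _; near=> m.
  rewrite pwB mulrA ler_pdivlMr // -pu.
  by near: m.
- by have := bn j; rewrite bj eqxx.
Unshelve. all: by end_near. Qed.

Lemma holder_littleo (R : realType) (kappa b A : R) (phi : R -> R)
    (u : nat -> R) :
  holder_real kappa phi -> b < kappa ->
  (forall m, u m != 0) -> u m @[m --> \oo] --> 0 ->
  (forall n : nat, b != n%:R) ->
  (\forall m \near \oo, `|phi (u m) - phi 0| <= A * `|u m| `^ b) ->
  `|phi (u m) - phi 0| / `|u m| `^ b @[m --> \oo] --> 0.
Proof.
move=> /holder_real_taylor[p0 [C [C0 hC]]] bk u0 u_cvg bn bnd.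
pose p := p0 - (phi 0)%:P.
have ub m c : 0 < `|u m| `^ c by rewrite powR_gt0 // normr_gt0.
have pwB m c c' : `|u m| `^ (c - c') = `|u m| `^ c / `|u m| `^ c'.
  by rewrite powRB // normr_eq0 u0 implybT.
have hp m : `|phi (u m) - phi 0 - p.[u m]| <= C * `|u m| `^ kappa.
  have := hC (u m); rewrite /p !hornerE; congr (`|_| <= _); ring.
have um1 : \forall m \near \oo, `|u m| <= 1.
  by apply: (cvgr_norm_le _ u_cvg); rewrite normr0 ltr01.
have p_cvg : `|p.[u m]| / `|u m| `^ b @[m --> \oo] --> 0.
  (* The increment of $\phi$ contributes [A] and the Taylor error [C]: once $|u_m|\le 1$,
     $|u_m|^\kappa\le|u_m|^b$ because $b<\kappa$. *)
  apply: (@horner_littleo _ _ _ _ (A + C)) => //.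
  near=> m.
  have -> : p.[u m] = phi (u m) - phi 0 - (phi (u m) - phi 0 - p.[u m]) by ring.
  apply: le_trans (ler_normB _ _) _; rewrite mulrDl lerD //; first by near: m.
  apply: le_trans (hp m) _; rewrite ler_wpM2l // ger_powR ?(ltW bk) //.
  by rewrite normr_gt0 u0 /=; near: m.
have r_cvg : `|p.[u m]| / `|u m| `^ b + C * `|u m| `^ (kappa - b)
    @[m --> \oo] --> 0.
  rewrite -[X in _ --> X](addr0 0); apply: cvgD => //.
  apply: (@cvg_mulr0 _ (fun=> C)); first exact: cvg_cst.
  by apply: cvg_powR0 => //; rewrite subr_gt0.
apply: squeeze_cvgr (cvg_cst 0) r_cvg; near=> m.
rewrite divr_ge0 ?powR_ge0 //= pwB mulrA -mulrDl.
rewrite ler_pM2r ?invr_gt0 //.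
rewrite -{1}(subrK p.[u m] (phi (u m) - phi 0)) addrC.
by apply: le_trans (ler_normD _ _) _; rewrite lerD2l.
Unshelve. all: by end_near. Qed.

(** * The functional equation on the closed disk *)

Lemma cvg_horner (K : numFieldType) (f : {poly K}) (z : K) :
  f.[w] @[w --> z] --> f.[z].
Proof.
elim/poly_ind: f => [|p a IH].
  rewrite horner0 (_ : (fun w => _) = cst 0).
    exact: (@cvg_cst _ _ _ _ (nbhs_filter z)).
  by apply/funext => w; rewrite horner0.
rewrite (eq_cvg _ _ (fun w => hornerMXaddC p a w)) hornerMXaddC.
apply: cvgD; [exact: (nbhs_filter z)| |exact: (@cvg_cst _ _ _ _ (nbhs_filter z))].
exact: (@cvgM _ _ _ (nbhs_filter z)).
Qed.

(** The points $(1-d)z$ with small $d>0$ lie in the open disk and tend to $z$. *)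
Lemma closed_disk_closure (R : realType) (r : R) (z : Cplx R) : 0 < r ->
  closed_disk r z -> closure (open_disk r) z.
Proof.
move=> r0 zr B /nbhs_ballP[e /= e0 eB].
(* Radii of balls are elements of [R[i]]; a positive one has zero imaginary part. *)
have [er eE] : exists er : R, e = real_complex R er.
  by exists (complex.Re e); apply/eqP; rewrite eq_complex /= eqxx /=;
     move: e0; rewrite ltcE => /andP[].
have er0 : 0 < er by move: e0; rewrite eE ltcR.
(* The bound $1$ keeps $1-d\ge 0$; the other gives $|z-(1-d)z|\le dr<er$. *)
pose d := Num.min 1 (er / (2 * r)).
have d0 : 0 < d by rewrite lt_min ltr01 divr_gt0 // mulr_gt0.
have d1 : d <= 1 by rewrite ge_min lexx.
have dr : d * r < er.
  apply: (@le_lt_trans _ _ (er / (2 * r) * r)).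
    by rewrite ler_wpM2r ?(ltW r0) // ge_min lexx orbT.
  by rewrite invfM mulrA divfK ?gt_eqF // ltr_pdivrMr // ltr_pMr // ltr1n.
have normr_re (x : R) : 0 <= x -> normc (real_complex R x) = x.
  by move=> x0; rewrite /= expr0n /= addr0 sqrtr_sqr ger0_norm.
exists (real_complex R (1 - d) * z); split.
  rewrite /open_disk /= Normc.normcM normr_re ?subr_ge0 //.
  apply: (@le_lt_trans _ _ ((1 - d) * r)).
    by rewrite ler_wpM2l ?subr_ge0.
  by rewrite mulrBl mul1r ltrBlDr ltrDl mulr_gt0.
apply: eB; rewrite -ball_normE /ball_ /=.
have -> : z - real_complex R (1 - d) * z = real_complex R d * z.
  by rewrite rmorphB rmorph1; ring.
rewrite /Num.norm /= -/(normc _) eE ltcR Normc.normcM normr_re ?(ltW d0) //.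
by apply: le_lt_trans dr; rewrite ler_wpM2l // ltW.
Qed.

(** Both sides are limits of their values along the open disk, where they agree. As $|a|=1$,
    multiplication by [a] preserves both disks. *)
Lemma linearizes_closed (R : realType) (f : {poly R[i]}) (a : Cplx R) (r : R)
    (h hbar : Cplx R -> Cplx R) (z : Cplx R) :
  0 < r -> normc a = 1 -> linearizes f a r h -> continuous_extension r h hbar ->
  closed_disk r z -> f.[hbar z] = hbar (a * z).
Proof.
move=> r0 a1 [_ _ _ lin] [/subspace_continuousP cont ext] zr.
have azr w : normc (a * w) = normc w by rewrite Normc.normcM a1 mul1r.
pose F := within (open_disk r) (nbhs z).
have PF : ProperFilter F.
  by apply: within_nbhs_proper; exact: closed_disk_closure.
have Fsub : F `=>` within (closed_disk r) (nbhs z).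
  move=> B; rewrite /F /within /=; apply: filterS => w Bw wr.
  by apply: Bw; exact: ltW.
have lim1 : (f.[hbar w] : Cplx R) @[w --> F] --> (f.[hbar z] : Cplx R).
  apply: (@cvg_comp _ _ _ hbar (horner f : Cplx R -> Cplx R) F (nbhs (hbar z))).
    by apply: cvg_trans (cont z zr); exact: cvg_app.
  exact: (@cvg_horner (complex R)).
have lim2 : hbar (a * w) @[w --> F] --> hbar (a * z).
  have azc : closed_disk r (a * z) by rewrite /closed_disk /= azr.
  apply: cvg_trans (cont (a * z) azc) => B.
  rewrite /F /within /=.
  have : (a * w : Cplx R) @[w --> z] --> a * z.
    apply: (@cvgM _ _ _ (nbhs_filter z)); last exact: cvg_id.
    exact: (@cvg_cst _ _ _ _ (nbhs_filter z)).
  move=> cva H; apply: (@filterS _ _ (nbhs_filter z) _ _ _ (cva _ H)).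
  move=> w /= Hw wr; apply: Hw.
  by rewrite /closed_disk /= azr; exact: ltW.
apply: (@cvg_unique _ (@norm_hausdorff _ (Cplx R)) _ _ _ _ lim1).
apply: cvg_trans lim2; apply: near_eq_cvg.
apply: (@filterS _ F _ (open_disk r)); last exact: withinT.
by move=> w wr; rewrite (ext w) // lin // ext // /open_disk /= azr.
Qed.

(** * The quadratic equation of $\sigma$ *)

(** Passing to the limit in $x_{m+1}=1/(k+x_m)$ gives $\sigma=1/(k+\sigma)$, from which the bounds
    follow. *)
Lemma cfrac_nseq_lim (R : realType) (k : nat) (sigma : R) : (1 <= k)%N ->
  cfrac R (nseq m k) @[m --> \oo] --> sigma ->
  [/\ sigma * (k%:R + sigma) = 1, 0 < sigma & sigma < 1].
Proof.
move=> k1 cvs.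
have a0 m : 0 <= cfrac R (nseq m k).
  by elim: m => //= m IH; rewrite invr_ge0 addr_ge0.
have s0 : 0 <= sigma.
  by apply: (ler_cvg_to (cvg_cst 0) cvs); apply: nearW.
have k1R : 1 <= k%:R :> R by rewrite ler1n.
have ks : 0 < k%:R + sigma by rewrite ltr_wpDr // (lt_le_trans ltr01).
have : cfrac R (nseq m.+1 k) @[m --> \oo] --> (k%:R + sigma)^-1.
  by rewrite /=; apply: cvgV; [rewrite gt_eqF|apply: cvgD => //; exact: cvg_cst].
have /(cvg_unique (@Rhausdorff R)) cu : cfrac R (nseq m.+1 k) @[m --> \oo] --> sigma.
  by rewrite (cvg_shiftS (fun m => cfrac R (nseq m k))).
move=> /cu sE.
have s1 : 0 < sigma by rewrite sE invr_gt0.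
split => //; first by rewrite {1}sE mulVf // gt_eqF.
by rewrite sE invf_lt1 // -[ltLHS]addr0 ler_ltD.
Qed.

(** * Modulus against real and imaginary parts *)

Lemma normc_ge_Re (R : realType) (z : R[i]) : `|complex.Re z| <= normc z.
Proof.
by case: z => a b /=; rewrite -sqrtr_sqr ler_wsqrtr // lerDl sqr_ge0.
Qed.

Lemma normc_ge_Im (R : realType) (z : R[i]) : `|complex.Im z| <= normc z.
Proof.
by case: z => a b /=; rewrite -sqrtr_sqr ler_wsqrtr // lerDr sqr_ge0.
Qed.

Lemma normc_le_ReIm (R : realType) (z : R[i]) :
  normc z <= `|complex.Re z| + `|complex.Im z|.
Proof.
case: z => a b /=; rewrite -(ger0_norm (addr_ge0 (normr_ge0 a) (normr_ge0 b))).
rewrite -sqrtr_sqr ler_wsqrtr // sqrrD !real_normK ?num_real //.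
by rewrite addrAC lerDl mulrn_wge0 // mulr_ge0.
Qed.

(** * The parameterization conjugates [f] to a rotation *)

Lemma natural_paramD_int (R : realType) (r theta : R) (hbar : Cplx R -> Cplx R)
    (t : R) (p : int) :
  natural_param r theta hbar (t + p%:~R) = natural_param r theta hbar t.
Proof.
rewrite /natural_param (_ : _ + theta = t + theta + p%:~R); last by ring.
by rewrite expi2piD expi2pi_int mulr1.
Qed.

Lemma natural_param_rotation (R : realType) (f : {poly R[i]})
    (sigma r theta : R) (h hbar : Cplx R -> Cplx R) (t : R) :
  0 < r -> linearizes f (expi2pi sigma) r h -> continuous_extension r h hbar ->
  f.[natural_param r theta hbar t] = natural_param r theta hbar (t + sigma).
Proof.
move=> r0 lin ext; rewrite /natural_param.
rewrite (linearizes_closed _ _ _ _ _ _ _ r0 (normc_expi2pi _ sigma) lin ext).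
  by rewrite mulrCA -expi2piD addrCA addrA.
rewrite /closed_disk /mkset Normc.normcM normc_expi2pi mulr1.
by rewrite /= expr0n /= addr0 sqrtr_sqr ger0_norm // ltW.
Qed.

Lemma natural_param_iter (R : realType) (f : {poly R[i]}) (sigma r theta : R)
    (h hbar : Cplx R -> Cplx R) (n : nat) :
  0 < r -> linearizes f (expi2pi sigma) r h -> continuous_extension r h hbar ->
  iter n (horner f) (natural_param r theta hbar 0)
    = natural_param r theta hbar (n%:R * sigma).
Proof.
move=> r0 lin ext; elim: n => [|n IH]; first by rewrite mul0r.
rewrite iterS IH -natr1 mulrDl mul1r.
exact: natural_param_rotation r0 lin ext.
Qed.

Theorem mainTheorem1 (R : realType) (k : nat) (sigma : R) (f : {poly R[i]})
    (rS : R) (h hbar : Cplx R -> Cplx R) (c : Cplx R) (theta : R)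
    (alpha : Cplx R) (C2 : R) :
  let D := siegel_disk rS h in
  let chi := natural_param rS theta hbar in
  let d := fun m : nat => (iter (cf_denom k m) (horner f) c - c : Cplx R) in
  let kappa_max := ln (normc alpha) / ln sigma in
  (1 <= k)%N ->
  cfrac R (nseq m k) @[m --> \oo] --> sigma ->
  f.[0] = 0 ->
  f^`().[0] = expi2pi sigma ->
  maximal_linearization f (expi2pi sigma) rS h ->
  is_jordan_curve (boundary D) ->
  (forall z, boundary D z /\ f^`().[z] = 0 <-> z = c) ->
  continuous_extension rS h hbar ->
  chi 0 = c ->
  (d m.+1 / d m : Cplx R) @[m --> \oo] --> alpha ->
  alpha != 0 ->
  0 < C2 ->
  (fun m : nat => normc (d m)) =
    (fun m : nat => C2 * normc alpha ^+ m)
      +o_\oo (fun m : nat => normc alpha ^+ m) ->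
  kappa_max \isn't a Num.int ->
  forall kappa : R, kappa \isn't a Num.int -> kappa_max < kappa ->
    ~ holder_class kappa chi.
Proof.
move=> D chi d b k1 cvs _ _ [r0 lin _] _ _ ext chi0 _ al0 C20 asym bint
  kappa _ bk [hRe hIm].
have [sE s0 s1] := cfrac_nseq_lim _ _ _ k1 cvs.
pose u m : R := (- sigma) ^+ m * sigma.
have dE m : d m = chi (u m) - chi 0.
  have [p uE] := cf_denom_approx _ _ m _ k1 sE.
  rewrite /d -chi0 (natural_param_iter _ _ _ _ _ _ _ _ r0 lin ext).
  (* Here [p] is the integer near $Q_m\sigma$; 1-periodicity replaces $Q_m\sigma$ by [u m]. *)
  have := natural_paramD_int _ rS theta hbar ((cf_denom k m)%:R * sigma) (- p).
  by rewrite mulrNz uE => <-.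
have u0 m : u m != 0 by rewrite mulf_neq0 ?expf_neq0 ?oppr_eq0 ?gt_eqF.
have u_cvg : u m @[m --> \oo] --> 0.
  rewrite (_ : u = geometric sigma (- sigma)).
    by apply: cvg_geometric; rewrite normrN gtr0_norm.
  by apply/funext => m; rewrite /u /= mulrC.
pose w := normc alpha.
have w0 : 0 < w.
  rewrite lt_neqAle eq_sym; apply/andP; split.
    by apply: contra al0 => /eqP /Normc.eq0_normc ->.
  by rewrite /w; case: (alpha) => x y /=; exact: sqrtr_ge0.
(* Since $|u_m|=\sigma^{m+1}$ and $\sigma^b=|\alpha|$, the exponent is $m+1$; this is why the
   constants below are divided by [w]. *)
have ub m : `|u m| `^ b = w ^+ m.+1.
  have -> : `|u m| = sigma `^ m.+1%:R.
    by rewrite powR_mulrn ?ltW // /u normrM normrX normrN gtr0_norm // -exprSr.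
  rewrite powRAC; have -> : sigma `^ b = w.
    by rewrite /powR gt_eqF // /b divfK ?lnK // ln_eq0 // lt_eqF.
  by rewrite powR_mulrn // ltW.
have bn (n : nat) : b != n%:R.
  by apply: contraNneq bint => ->; exact: natr_int.
have C22 : 0 < C2 / 2 by rewrite divr_gt0.
(* The little-o term is taken with constant $C_2/2$, which leaves a positive lower bound. *)
have [d_ge d_le] : (\forall m \near \oo, C2 / 2 * w ^+ m <= normc (d m)) /\
    (\forall m \near \oo, normc (d m) <= (C2 + C2 / 2) * w ^+ m).
  have /eqaddoP/(_ _ C22) asym' := asym.
  have wm m : 0 <= w ^+ m by rewrite exprn_ge0 // ltW.
  by split; apply: filterS asym' => m; rewrite !fctE /= -/w (ger0_norm (wm m))
    ler_norml => /andP[]; have := wm m; lra.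
pose A := (C2 + C2 / 2) / w.
have bound : \forall m \near \oo, normc (d m) <= A * `|u m| `^ b.
  apply: filterS d_le => m; congr (_ <= _).
  by rewrite ub exprS mulrA divfK // gt_eqF.
have reE m : complex.Re (chi (u m)) - complex.Re (chi 0) = complex.Re (d m).
  by rewrite dE; case: (chi (u m)) (chi 0) => ? ? [].
have imE m : complex.Im (chi (u m)) - complex.Im (chi 0) = complex.Im (d m).
  by rewrite dE; case: (chi (u m)) (chi 0) => ? ? [].
(* Real and imaginary parts are treated separately, each bounded by the modulus of [d m]. *)
have re_cvg : `|complex.Re (d m)| / `|u m| `^ b @[m --> \oo] --> 0.
  rewrite -(eq_cvg _ _ (fun m => congr1 (fun x => `|x| / _) (reE m))).
  apply: (holder_littleo _ _ _ A _ _ hRe bk u0 u_cvg bn); apply: filterS bound => m.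
  by rewrite reE; apply: le_trans; exact: normc_ge_Re.
have im_cvg : `|complex.Im (d m)| / `|u m| `^ b @[m --> \oo] --> 0.
  rewrite -(eq_cvg _ _ (fun m => congr1 (fun x => `|x| / _) (imE m))).
  apply: (holder_littleo _ _ _ A _ _ hIm bk u0 u_cvg bn); apply: filterS bound => m.
  by rewrite imE; apply: le_trans; exact: normc_ge_Im.
(* In units of $|u_m|^b$ the lower bound on $|d_m|$ is $C_2/(2w)$, while
   $|\mathrm{Re}\,d_m|+|\mathrm{Im}\,d_m|$ tends to [0 + 0]; one large [m] gives the
   contradiction. *)
have eps0 : 0 + 0 < C2 / 2 / w by rewrite addr0 divr_gt0.
have [m [/= dm]] := filter_ex (filterI d_ge (cvgr_lt _ (cvgD re_cvg im_cvg) _ eps0)).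
rewrite fctE -mulrDl ub ltr_pdivrMr ?exprn_gt0 // exprS mulrA divfK ?gt_eqF //.
by apply/negP; rewrite -leNgt; apply: le_trans dm (normc_le_ReIm _ _).
Qed.
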